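(* Let $A$ be a real symmetric positive definite $N\times N$ matrix with a block decomposition $A=(A_{i,j})_{1\le i,j\le d}$, where $A_{i,j}$ has size $n_i\times n_j$ and $n_1+\dots+n_d=N$. Let $B$ be the block diagonal matrix with diagonal blocks $\beta_i\,\mathrm{Id}_{n_i}$, $\beta_i\ge0$, $i=1,\dots,d$. Let $\tau>0$, $\Delta t>0$, and consider the scheme $$\frac{U^{(k+1)}-U^{(k)}}{\Delta t}+\tau B\,(U^{(k+1)}-U^{(k)})=-AU^{(k)},\qquad k\ge0,\quad U^{(0)}\in\mathbb{R}^N .$$ If $$\frac{1}{\Delta t}+\tau\beta_i-\frac14\sum_{j=1}^d\left(\|A_{i,j}\|+\|A_{j,i}\|\right)>0\qquad\text{for all } i=1,\dots,d,$$ then the scheme is stable.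
   Context: $\mathrm{Id}_{n}$ is the $n\times n$ identity matrix, $\langle\cdot,\cdot\rangle$ is the Euclidean scalar product, and $\|A_{i,j}\|$ is the operator norm induced by the Euclidean norms. ''Stable'' means energy stability in the $A$-norm: for every initial vector $U^{(0)}$ and every $k\ge0$ with $U^{(k+1)}\neq U^{(k)}$ one has $\langle AU^{(k+1)},U^{(k+1)}\rangle<\langle AU^{(k)},U^{(k)}\rangle$. *)

(* Defs.v *)
From mathcomp Require Import all_boot all_order all_algebra.
From mathcomp Require Import classical_sets reals.

Set Implicit Arguments.
Unset Strict Implicit.
Unset Printing Implicit Defensive.

Import Order.TTheory GRing.Theory Num.Theory.
Local Open Scope classical_set_scope.
Local Open Scope ring_scope.

Definition dotv (R : realType) (n : nat) (u v : 'cV[R]_n) : R :=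
  \sum_(i < n) u i 0 * v i 0.

Definition l2norm (R : realType) (n : nat) (u : 'cV[R]_n) : R :=
  Num.sqrt (dotv u u).

(* The supremum is over the closed unit ball, so the set is nonempty (it
   contains 0) even for n = 0, and it is bounded: [sup] is never applied
   outside its meaningful range. *)
Definition opnorm (R : realType) (m n : nat) (M : 'M[R]_(m, n)) : R :=
  sup [set l2norm (M *m x) | x in [set x : 'cV[R]_n | l2norm x <= 1]].

Definition spd (R : realType) (n : nat) (A : 'M[R]_n) : Prop :=
  A^T = A /\ forall x : 'cV[R]_n, x != 0 -> 0 < dotv (A *m x) x.

Definition scheme (R : realType) (n : nat) (A B : 'M[R]_n) (tau dt : R)
    (U0 : 'cV[R]_n) (U : nat -> 'cV[R]_n) : Prop :=
  U 0%N = U0 /\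
  forall k : nat,
    dt^-1 *: (U k.+1 - U k) + tau *: (B *m (U k.+1 - U k)) = - (A *m U k).

Definition stable (R : realType) (n : nat) (A B : 'M[R]_n) (tau dt : R)
    : Prop :=
  forall (U0 : 'cV[R]_n) (U : nat -> 'cV[R]_n), scheme A B tau dt U0 U ->
  forall k : nat, U k.+1 <> U k ->
    dotv (A *m U k.+1) (U k.+1) < dotv (A *m U k) (U k).

(* Main.v *)
(* Write D = U^(k+1) - U^k and C = dt^-1 Id + tau B, so the scheme reads
   C D = - A U^k.  By symmetry of A the energy changes by
   2 <A U^k, D> + <A D, D> = <A D, D> - 2 <C D, D>.
   Splitting D into its blocks D_i, Cauchy-Schwarz and 2ab <= a^2 + b^2 give
   <A D, D> <= sum_i (1/2 sum_j (|A_ij| + |A_ji|)) |D_i|^2, which by hypothesis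
   is smaller than 2 <C D, D> = 2 sum_i (1/dt + tau beta_i) |D_i|^2. *)
Require Import Defs.
From mathcomp Require Import all_boot all_order all_algebra.
From mathcomp Require Import classical_sets reals.
From mathcomp Require Import ring lra.

Set Implicit Arguments.
Unset Strict Implicit.
Unset Printing Implicit Defensive.

Import Order.TTheory GRing.Theory Num.Theory.
Local Open Scope ring_scope.

Lemma dotvC (R : realType) (n : nat) (u v : 'cV[R]_n) : dotv u v = dotv v u.
Proof. by apply: eq_bigr => i _; rewrite mulrC. Qed.

Lemma dotvDl (R : realType) (n : nat) (u v w : 'cV[R]_n) :
  dotv (u + v) w = dotv u w + dotv v w.
Proof. by rewrite -big_split; apply: eq_bigr => i _; rewrite !mxE mulrDl. Qed.

Lemma dotvZl (R : realType) (n : nat) (a : R) (u v : 'cV[R]_n) :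
  dotv (a *: u) v = a * dotv u v.
Proof. by rewrite mulr_sumr; apply: eq_bigr => i _; rewrite !mxE mulrA. Qed.

Lemma dotvDr (R : realType) (n : nat) (u v w : 'cV[R]_n) :
  dotv u (v + w) = dotv u v + dotv u w.
Proof. by rewrite dotvC dotvDl !(dotvC u). Qed.

Lemma dotvZr (R : realType) (n : nat) (a : R) (u v : 'cV[R]_n) :
  dotv u (a *: v) = a * dotv u v.
Proof. by rewrite dotvC dotvZl dotvC. Qed.

Lemma dotvE (R : realType) (n : nat) (u v : 'cV[R]_n) :
  dotv u v = (u^T *m v) 0 0.
Proof. by rewrite mxE; apply: eq_bigr => i _; rewrite mxE. Qed.

Lemma dotv_sum (R : realType) (n : nat) (I : finType) (F : I -> 'cV[R]_n)
    (v : 'cV[R]_n) : dotv (\sum_i F i) v = \sum_i dotv (F i) v.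
Proof.
rewrite dotvE raddf_sum mulmx_suml summxE.
by apply: eq_bigr => i _; rewrite dotvE.
Qed.

Lemma dotv_mulmx (R : realType) (m n : nat) (M : 'M[R]_(m, n))
    (x : 'cV[R]_n) (y : 'cV[R]_m) : dotv (M *m x) y = dotv x (M^T *m y).
Proof. by rewrite !dotvE trmx_mul mulmxA. Qed.

Lemma dotv_ge0 (R : realType) (n : nat) (u : 'cV[R]_n) : 0 <= dotv u u.
Proof. by apply: sumr_ge0 => i _; rewrite -expr2 sqr_ge0. Qed.

Lemma dotv_eq0 (R : realType) (n : nat) (u : 'cV[R]_n) :
  (dotv u u == 0) = (u == 0).
Proof.
apply/idP/eqP => [|->]; last by rewrite /dotv big1 // => i _; rewrite mxE mul0r.
rewrite psumr_eq0 => [/allP u0|i _]; last by rewrite -expr2 sqr_ge0.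
apply/colP => i; have := u0 i; rewrite mem_index_enum mxE mulf_eq0 orbb.
by move=> /(_ isT)/eqP.
Qed.

Lemma dotv_gt0 (R : realType) (n : nat) (u : 'cV[R]_n) :
  (0 < dotv u u) = (u != 0).
Proof. by rewrite lt0r dotv_ge0 andbT dotv_eq0. Qed.

Lemma l2norm_ge0 (R : realType) (n : nat) (u : 'cV[R]_n) : 0 <= l2norm u.
Proof. exact: sqrtr_ge0. Qed.

Lemma sqr_l2norm (R : realType) (n : nat) (u : 'cV[R]_n) :
  l2norm u ^+ 2 = dotv u u.
Proof. by rewrite sqr_sqrtr ?dotv_ge0. Qed.

Lemma l2normZ (R : realType) (n : nat) (a : R) (u : 'cV[R]_n) :
  l2norm (a *: u) = `|a| * l2norm u.
Proof.
by rewrite /l2norm dotvZl dotvZr mulrA -expr2 sqrtrM ?sqr_ge0 // sqrtr_sqr.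
Qed.

Lemma l2norm_eq0 (R : realType) (n : nat) (u : 'cV[R]_n) :
  (l2norm u == 0) = (u == 0).
Proof. by rewrite -dotv_eq0 -sqr_l2norm sqrf_eq0. Qed.

(** With [b = dotv v v] and [c = dotv u v], the vector [b *: u - c *: v] has squared length
    [b * (dotv u u * b - c ^+ 2)], which is nonnegative. The factor [b] cancels unless [v = 0]. *)
Lemma cauchy_schwarz_sqr (R : realType) (n : nat) (u v : 'cV[R]_n) :
  dotv u v ^+ 2 <= dotv u u * dotv v v.
Proof.
have [->|v0] := eqVneq v 0.
  by rewrite -(scale0r (0 : 'cV[R]_n)) !dotvZr !mul0r expr0n mulr0.
have vv_gt0 : 0 < dotv v v by rewrite dotv_gt0.
have := dotv_ge0 (dotv v v *: u + (- dotv u v) *: v).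
rewrite !(dotvDl, dotvDr, dotvZl, dotvZr) (dotvC v u).
set a := dotv u u; set b := dotv v v in vv_gt0 *; set c := dotv u v => h.
rewrite -subr_ge0 -(pmulr_rge0 _ vv_gt0); suff -> : b * (a * b - c ^+ 2) =
  b * (b * a) + - c * (b * c) + (b * (- c * c) + - c * (- c * b)) by lra.
by ring.
Qed.

Lemma cauchy_schwarz (R : realType) (n : nat) (u v : 'cV[R]_n) :
  dotv u v <= l2norm u * l2norm v.
Proof.
rewrite (le_trans (ler_norm _)) // -(@ler_pXn2r _ 2) // ?nnegrE //.
  by rewrite exprMn !sqr_l2norm -normrX ger0_norm ?sqr_ge0 // cauchy_schwarz_sqr.
by rewrite mulr_ge0 ?l2norm_ge0.
Qed.

(** Cauchy-Schwarz on each row of [M]. The constant is the squared Frobenius norm; it is far from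
    sharp, but it serves to show that the set defining [opnorm M] is bounded. *)
Lemma dotv_mulmx_le (R : realType) (m n : nat) (M : 'M[R]_(m, n))
    (x : 'cV[R]_n) :
  dotv (M *m x) (M *m x) <=
  (\sum_(i < m) dotv (row i M)^T (row i M)^T) * dotv x x.
Proof.
rewrite mulr_suml; apply: ler_sum => i _.
suff -> : (M *m x) i 0 = dotv (row i M)^T x by rewrite -expr2 cauchy_schwarz_sqr.
by rewrite mxE; apply: eq_bigr => j _; rewrite !mxE.
Qed.

Lemma opnorm_ub (R : realType) (m n : nat) (M : 'M[R]_(m, n)) (x : 'cV[R]_n) :
  l2norm x <= 1 -> l2norm (M *m x) <= opnorm M.
Proof.
move=> x1; apply: ub_le_sup; last by exists x.
exists (Num.sqrt (\sum_(i < m) dotv (row i M)^T (row i M)^T)) => _ [y /= y1 <-].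
have C0 : 0 <= \sum_(i < m) dotv (row i M)^T (row i M)^T.
  by apply: sumr_ge0 => i _; exact: dotv_ge0.
rewrite ler_sqrt // (le_trans (dotv_mulmx_le _ _)) // ler_piMr //.
by rewrite -sqr_l2norm expr_le1 ?l2norm_ge0.
Qed.

(** By homogeneity: the bound on the unit ball is applied to [x] divided by its norm, so [x = 0] is
    treated apart. *)
Lemma l2norm_mulmx_le (R : realType) (m n : nat) (M : 'M[R]_(m, n))
    (x : 'cV[R]_n) : l2norm (M *m x) <= opnorm M * l2norm x.
Proof.
have [->|x0] := eqVneq x 0.
  by rewrite mulmx0 -(scale0r (0 : 'cV[R]_m)) -(scale0r (0 : 'cV[R]_n))
             !l2normZ normr0 !mul0r mulr0.
have x_gt0 : 0 < l2norm x by rewrite lt0r l2norm_eq0 x0 l2norm_ge0.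
have := @opnorm_ub _ _ _ M ((l2norm x)^-1 *: x).
rewrite -scalemxAr !l2normZ ger0_norm ?invr_ge0 ?l2norm_ge0 //.
by rewrite mulVf ?gt_eqF // mulrC ler_pdivrMr //; apply.
Qed.

Lemma opnorm_ge0 (R : realType) (m n : nat) (M : 'M[R]_(m, n)) : 0 <= opnorm M.
Proof.
apply: le_trans (l2norm_ge0 (M *m 0)) (opnorm_ub _ _).
by rewrite /l2norm /dotv big1 ?sqrtr0 // => i _; rewrite mxE mul0r.
Qed.

Lemma dotv_mulmx_opnorm (R : realType) (m n : nat) (M : 'M[R]_(m, n))
    (x : 'cV[R]_n) (y : 'cV[R]_m) :
  dotv (M *m x) y <= 2^-1 * opnorm M * (dotv x x + dotv y y).
Proof.
apply: le_trans (cauchy_schwarz _ _) _.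
apply: le_trans (ler_wpM2r (l2norm_ge0 _) (l2norm_mulmx_le _ _)) _.
rewrite -!sqr_l2norm.
(* Young's inequality as an identity: the gap between the two sides is a nonnegative multiple of a
   square. *)
have -> : 2^-1 * opnorm M * (l2norm x ^+ 2 + l2norm y ^+ 2) =
    opnorm M * l2norm x * l2norm y
    + 2^-1 * opnorm M * (l2norm x - l2norm y) ^+ 2 by field.
by rewrite lerDl mulr_ge0 ?sqr_ge0 // mulr_ge0 ?opnorm_ge0 // invr_ge0 ler0n.
Qed.

Section Blocks.

Variables (R : realType) (d : nat) (n : 'I_d -> nat).
Implicit Types (u v : 'cV[R]_(\sum_(i < d) n i)).

Lemma dotv_submxcol u v :
  dotv u v = \sum_(i < d) dotv (submxcol u i) (submxcol v i).
Proof.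
rewrite dotvE -{1}(submxcolK u) -{1}(submxcolK v) tr_mxcol mul_mxrow_mxcol.
by rewrite summxE; apply: eq_bigr => i _; rewrite dotvE.
Qed.

Lemma submxcol_mulmx (A : 'M[R]_(\sum_(i < d) n i)) v (i : 'I_d) :
  submxcol (A *m v) i = \sum_(j < d) submxblock A i j *m submxcol v j.
Proof.
by rewrite -{1}(submxblockK A) -{1}(submxcolK v) mul_mxblock_mxrow mxcolK.
Qed.

Lemma submxcol_mxdiag_scalar (beta : 'I_d -> R) v (i : 'I_d) :
  submxcol (\mxdiag_(i < d) (beta i)%:M *m v) i = beta i *: submxcol v i.
Proof.
rewrite submxcol_mulmx (bigD1 i) //= big1 ?addr0 => [|j ji].
  (* [\mxdiag] wraps its diagonal blocks in [conform_mx] so that they type-check at size [n i] by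
     [n j]; at [j = i] the wrapper disappears. *)
  by rewrite /mxdiag mxblockK eqxx conform_mx_id mul_scalar_mx.
by rewrite /mxdiag mxblockK eq_sym (negbTE ji) mul0mx.
Qed.

(** Young's inequality on block [(i, j)] charges half of its norm to [submxcol v i] and half to
    [submxcol v j]. Hence block [i] of [v] is charged once along row [i] and once along column [i]
    of [A]. *)
Lemma dotv_mulmx_blocks_le (A : 'M[R]_(\sum_(i < d) n i)) v :
  dotv (A *m v) v <=
  \sum_(i < d) 2^-1 * (\sum_(j < d) (opnorm (submxblock A i j)
      + opnorm (submxblock A j i))) * dotv (submxcol v i) (submxcol v i).
Proof.
have -> : dotv (A *m v) v = \sum_(i < d) \sum_(j < d)
    dotv (submxblock A i j *m submxcol v j) (submxcol v i).
  rewrite dotv_submxcol; apply: eq_bigr => i _.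
  by rewrite submxcol_mulmx dotv_sum.
set N := fun i j => opnorm (submxblock A i j).
set q := fun i => dotv (submxcol v i) (submxcol v i).
suff -> : \sum_(i < d) 2^-1 * (\sum_(j < d) (N i j + N j i)) * q i =
    \sum_(i < d) \sum_(j < d) 2^-1 * N i j * (q j + q i).
  by apply: ler_sum => i _; apply: ler_sum => j _; exact: dotv_mulmx_opnorm.
transitivity (\sum_(i < d) \sum_(j < d) 2^-1 * N i j * q i +
              \sum_(i < d) \sum_(j < d) 2^-1 * N j i * q i).
  rewrite -big_split; apply: eq_bigr => i _.
  rewrite -mulrA mulr_suml mulr_sumr -big_split.
  by apply: eq_bigr => j _ /=; ring.
(* Swapping the two indices in the column part turns its weight [N j i * q i] into [N i j * q j]. *)
rewrite [X in _ + X]exchange_big -big_split; apply: eq_bigr => i _.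
by rewrite -big_split; apply: eq_bigr => j _ /=; ring.
Qed.

End Blocks.

Unset Implicit Arguments.

Theorem theorem2p5 (R : realType) (d : nat) (n : 'I_d -> nat)
    (A : 'M[R]_(\sum_(i < d) n i)) (hA : spd A)
    (beta : 'I_d -> R) (hbeta : forall i : 'I_d, 0 <= beta i)
    (tau dt : R) (htau : 0 < tau) (hdt : 0 < dt)
    (hcond : forall i : 'I_d,
      0 < dt^-1 + tau * beta i
          - 4^-1 * \sum_(j < d) (opnorm (submxblock A i j)
                                 + opnorm (submxblock A j i))) :
  stable A (\mxdiag_(i < d) (beta i)%:M) tau dt.
Proof.
move=> U0 U [_ hU] k hk; have := hU k.
set B := \mxdiag_(i < d) _; set V := U k; set D := U k.+1 - V => hD.
have D0 : D != 0 by rewrite subr_eq0; apply/eqP.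
have -> : U k.+1 = V + D by rewrite addrC subrK.
clearbody D.
have AVD : dotv (A *m V) D = - (dt^-1 * dotv D D + tau * dotv (B *m D) D).
  (* This is the scheme tested against the increment [D]. *)
  rewrite -dotvZl -dotvZl -dotvDl hD -[in RHS]scaleN1r dotvZl; ring.
have AVDC : dotv (A *m D) V = dotv (A *m V) D.
  by rewrite dotv_mulmx (proj1 hA) dotvC.
rewrite mulmxDr !dotvDl !dotvDr AVDC AVD.
suff : dotv (A *m D) D < 2 * (dt^-1 * dotv D D + tau * dotv (B *m D) D) by lra.
apply: le_lt_trans (dotv_mulmx_blocks_le _ _) _.
rewrite !(dotv_submxcol _ D) (mulr_sumr _ _ _ dt^-1) (mulr_sumr _ _ _ tau).
rewrite -big_split (mulr_sumr _ _ _ 2) -subr_gt0 -sumrB /=.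
pose q i := dotv (submxcol D i) (submxcol D i).
(* [c i] is the quantity assumed positive. The gap to be shown positive is the sum of
   [2 * c i * q i]: the factor 2 turns the [4^-1] of the hypothesis into the [2^-1] of the block
   estimate. *)
pose c i := dt^-1 + tau * beta i - 4^-1 * \sum_(j < d)
  (opnorm (submxblock A i j) + opnorm (submxblock A j i)).
rewrite (eq_bigr (fun i => 2 * c i * q i)) => [|i _]; last first.
  by rewrite submxcol_mxdiag_scalar dotvZl /c -/(q i); field; rewrite gt_eqF.
have cq_ge0 i : 0 <= 2 * c i * q i.
  by rewrite mulr_ge0 ?dotv_ge0 // mulr_ge0 // ltW // hcond.
(* Strictness: if this sum of nonnegative terms vanished, each term would, hence each [q i] since
   [c i] is positive, and then [D = 0]. *)
rewrite lt0r sumr_ge0 // andbT; apply: contra D0 => /eqP cq0.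
have q0 i : q i = 0.
  have /eqP : 2 * c i * q i = 0 by apply: (psumr_eq0P _ cq0).
  by rewrite !mulf_eq0 pnatr_eq0 /= gt_eqF ?hcond //= => /eqP.
by rewrite -dotv_eq0 dotv_submxcol big1 // => i _; exact: q0.
Qed.
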